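(* In its natural permutation representation of degree $22$, the Mathieu group $M_{22}$ does not contain a sharply transitive set of permutations.
   Context: A set $S$ of permutations of a finite set $\Omega$ is called sharply transitive on $\Omega$ if for all $x,y\in\Omega$ there is a unique $s\in S$ with $x^s=y$ (where $x^s$ is the image of $x$ under $s$); $S$ need not be a subgroup. The Witt design $\mathcal W_{23}$ is the (unique up to isomorphism) Steiner system with $23$ points and blocks of size $7$ such that any $4$ distinct points lie in exactly one block. The Mathieu group $M_{23}$ is its automorphism group, acting on the $23$ points $\{1,\ldots,23\}$. The Mathieu group $M_{22}$ in its natural action of degree $22$ is the stabilizer in $M_{23}$ of the point $23$, acting on the remaining $22$ points $\{1,\ldots,22\}$. *)

(* Defs.v *)
From mathcomp Require Import all_boot all_fingroup.

Set Implicit Arguments.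
Unset Strict Implicit.
Unset Printing Implicit Defensive.

Import GroupScope.

Definition sharply_transitive (T : finType) (S : {set {perm T}}) : Prop :=
  forall x y : T, exists! s : {perm T}, s \in S /\ s x = y.

Definition steiner_system (T : finType) (t k : nat) (W : {set {set T}}) : Prop :=
  (forall B : {set T}, B \in W -> #|B| = k) /\
  (forall A : {set T}, #|A| = t ->
     exists! B : {set T}, B \in W /\ A \subset B).

(* The design is only unique up to isomorphism, so this is a predicate on its  *)
(* block set; the points 1, ..., 23 are the elements 0, ..., 22 of 'I_23.      *)
Definition witt_design23 (W : {set {set 'I_23}}) : Prop := steiner_system 4 7 W.

(* The automorphism group of the design with block set W: a permutation of the *)
(* points lies in 'N(W | 'P^* ) when its image action maps blocks to blocks.   *)
Definition M23 (W : {set {set 'I_23}}) : {group 'S_23} := 'N(W | 'P^* )%G.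

(* lift_perm ord_max ord_max s is the extension of s : 'S_22 to 'I_23 fixing   *)
(* the last point, so this is the permutation group of degree 22 which the     *)
(* stabilizer of that point in M23 induces on the remaining 22 points.         *)
Definition M22 (W : {set {set 'I_23}}) : {set 'S_22} :=
  [set s : 'S_22 |
    lift_perm ord_max ord_max s \in 'C_(M23 W)[ord_max | 'P]].

Lemma M22_group_set (W : {set {set 'I_23}}) : group_set (M22 W).
Proof.
apply/group_setP; split; first by rewrite in_set lift_perm1 group1.
move=> s t; rewrite [s \in _]in_set [t \in _]in_set [_ \in M22 W]in_set.
by rewrite -(lift_permM _ ord_max); apply: groupM.
Qed.

Canonical M22_group (W : {set {set 'I_23}}) : {group 'S_22} :=
  Group (M22_group_set W).

(* Main.v *)
Require Import Defs.
From mathcomp Require Import all_boot all_fingroup.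

(** The obstruction is a parity argument.  Any two blocks of the Witt design
    on 23 points meet in 1, 3 or 7 points, hence always in an odd number
    ([witt23_odd_meet]).  Choose a block [C] missing the point fixed by M22
    ([witt23_block_avoiding]); it is a set of 7 of the 22 remaining points, and
    its preimage under an element of M22 is again such a block, so that every
    [s] in M22 satisfies [odd #|C :&: s @^-1: C|] ([M22_odd_meet]).

    If [S] is sharply transitive, the sum over [s] in [S] of these numbers
    counts the pairs of points of [C], once each through the only element of
    [S] taking the first point to the second, and is therefore 7 * 7 = 49
    ([sharply_transitive_sum]).  But [S] has 22 elements, and a sum of 22 odd
    numbers is even.

    The intersection sizes follow from the design axioms alone: for a fixed
    block [C] and [j <= 4], the sum over all blocks [B] of the binomial
    coefficients ['C(#|B :&: C|, j)] is determined by double counting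
    ([steiner_sum_bin]), and a suitable linear combination of these sums is
    the number of blocks which meet [C] in an even number of points. *)

(** * Counting subsets *)

Lemma card_between (T : finType) (A B : {set T}) (m : nat) :
  A \subset B -> #|A| <= m ->
  #|[set D : {set T} | [&& A \subset D, D \subset B & #|D| == m]]|
    = 'C(#|B| - #|A|, m - #|A|).
Proof.
move=> sAB leAm.
have <- : #|B :\: A| = #|B| - #|A| by rewrite cardsD (setIidPr sAB).
rewrite -cards_draws -[RHS](card_in_imset (f := fun E => A :|: E)).
  apply: eq_card => D; rewrite inE; apply/and3P/imsetP.
    move=> [sAD sDB /eqP cD]; exists (D :\: A).
      by rewrite inE setSD // cardsD (setIidPr sAD) cD eqxx.
    by rewrite -{1}(setIidPr sAD) setID.
  move=> [E]; rewrite inE subsetD => /andP[/andP[sEB dEA] /eqP cE] ->.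
  split; first exact: subsetUl.
    by rewrite subUset sAB.
  rewrite cardsU disjoint_setI0 1?disjoint_sym // cards0 cE subn0.
  by rewrite subnKC.
move=> E F; rewrite !inE !subsetD => /andP[/andP[_ dE] _] /andP[/andP[_ dF] _].
move=> /(congr1 (fun D => D :\: A)).
by rewrite !setDUl setDv !set0U !(setDidPl _).
Qed.

(** * Steiner systems *)

(** Double counting of the pairs of a block [B] and a [t]-set between [A] and
    [B]: each of the [t]-sets containing [A] lies in a single block. *)
Lemma steiner_degree (T : finType) (t k : nat) (W : {set {set T}})
    (A : {set T}) :
  steiner_system t k W -> #|A| <= t ->
  #|[set B in W | A \subset B]| * 'C(k - #|A|, t - #|A|)
    = 'C(#|T| - #|A|, t - #|A|).
Proof.
move=> [cW uW] leAt; rewrite -cardsT -card_between ?subsetT //.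
transitivity (\sum_(B in W | A \subset B)
    \sum_(D : {set T} | [&& A \subset D, D \subset B & #|D| == t]) 1).
  rewrite -sum1dep_card big_distrl; apply: eq_bigr => B /andP[BW sAB].
  by rewrite /= mul1n sum1dep_card card_between ?(cW B BW).
rewrite (exchange_big_dep (fun D : {set T} => (A \subset D) && (#|D| == t))).
  rewrite -sum1dep_card; apply: eq_big => [D|D /andP[sAD /eqP cD]].
    by rewrite subsetT.
  have [B [[BW sDB] uB]] := uW D cD.
  rewrite (big_pred1 B) // => B' /=; rewrite sAD cD eqxx andbT /=.
  apply/idP/eqP => [/andP[/andP[B'W _] sDB']|->].
    by rewrite (uB B').
  by rewrite BW sDB (subset_trans sAD sDB).
by move=> B D _ /and3P[-> _ ->].
Qed.

(** Both sides count the pairs of a [j]-subset [A] of [C] and a block through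
    [A]; the number of blocks through [A] depends on [j] only. *)
Lemma steiner_sum_bin (T : finType) (t k : nat) (W : {set {set T}})
    (C : {set T}) (j : nat) :
  steiner_system t k W -> j <= t ->
  (\sum_(B in W) 'C(#|B :&: C|, j)) * 'C(k - j, t - j)
    = 'C(#|C|, j) * 'C(#|T| - j, t - j).
Proof.
move=> hW lejt.
transitivity (\sum_(B in W)
    \sum_(A : {set T} | (A \subset B) && ((A \subset C) && (#|A| == j)))
      'C(k - j, t - j)).
  rewrite big_distrl; apply: eq_bigr => B _.
  rewrite -cards_draws sum_nat_const; congr (_ * _); apply: eq_card => A.
  by rewrite inE subsetI -andbA.
rewrite (exchange_big_dep (fun A : {set T} => (A \subset C) && (#|A| == j))).
  rewrite -cards_draws -sum1dep_card big_distrl.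
  apply: eq_bigr => A /andP[sAC /eqP cA] /=.
  rewrite mul1n -cA -(steiner_degree _ t k W) ?cA //.
  rewrite -sum1dep_card big_distrl; apply: eq_big => [B|B _].
    by rewrite sAC eqxx !andbT.
  by rewrite /= mul1n.
by move=> B A _ /andP[].
Qed.

Lemma steiner_block_eq (T : finType) (t k : nat) (W : {set {set T}})
    (B C : {set T}) :
  steiner_system t k W -> B \in W -> C \in W -> t <= #|B :&: C| -> B = C.
Proof.
move=> [_ uW] BW CW; rewrite -bin_gt0 -cards_draws.
move=> /card_gt0P[A]; rewrite inE subsetI => /andP[/andP[sAB sAC] /eqP cA].
by have [D [_ uD]] := uW A cA; rewrite -(uD B) // -(uD C).
Qed.

(** * The Witt design on 23 points *)

Lemma witt23_sum_bin (W : {set {set 'I_23}}) (C : {set 'I_23}) (j n : nat) :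
  witt_design23 W -> C \in W -> j <= 4 ->
  'C(7, j) * 'C(23 - j, 4 - j) = n * 'C(7 - j, 4 - j) ->
  \sum_(B in W) 'C(#|B :&: C|, j) = n.
Proof.
move=> hW CW lej4 def_n; apply/eqP.
have bin_gt : 0 < 'C(7 - j, 4 - j) by rewrite bin_gt0 leq_sub2r.
rewrite -(eqn_pmul2r bin_gt) (steiner_sum_bin _ 4 7 W C j hW lej4).
by case: hW => cW _; rewrite (cW C CW) card_ord def_n.
Qed.

Lemma witt23_degree (W : {set {set 'I_23}}) (A : {set 'I_23}) (n : nat) :
  witt_design23 W -> #|A| <= 4 ->
  'C(23 - #|A|, 4 - #|A|) = n * 'C(7 - #|A|, 4 - #|A|) ->
  #|[set B in W | A \subset B]| = n.
Proof.
move=> hW leA4 def_n; apply/eqP.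
have bin_gt : 0 < 'C(7 - #|A|, 4 - #|A|) by rewrite bin_gt0 leq_sub2r.
rewrite -(eqn_pmul2r bin_gt) (steiner_degree _ 4 7 W A hW leA4).
by rewrite card_ord def_n.
Qed.

(** The indicator of the even numbers is [i |-> (1 + (-1) ^ i) / 2], and
    expanding [(-1) ^ i = (1 - 2) ^ i] makes it
    [1 - i + 2 * 'C(i, 2) - 4 * 'C(i, 3)] for [i < 4].  A block other than [C]
    meets [C] in fewer than 4 points, so summing this expression over the
    blocks, with a correction at [C] itself, yields the number of blocks that
    meet [C] evenly, which turns out to be 0. *)
Lemma witt23_odd_meet (W : {set {set 'I_23}}) (B C : {set 'I_23}) :
  witt_design23 W -> B \in W -> C \in W -> odd #|B :&: C|.
Proof.
move=> hW BW CW.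
(* For D = C the intersection has 7 points, and 104 is the error made there:
   7 + 4 * 35 = 1 + 2 * 21 + 104. *)
have even_bin D : D \in W ->
    ~~ odd #|D :&: C| + 'C(#|D :&: C|, 1) + 4 * 'C(#|D :&: C|, 3)
      = 'C(#|D :&: C|, 0) + 2 * 'C(#|D :&: C|, 2) + 104 * (D == C).
  move=> DW; have [->|neDC] := eqVneq D C.
    by rewrite setIid; case: hW => cW _; rewrite (cW C CW).
  have : #|D :&: C| < 4.
    rewrite ltnNge; apply: contra neDC => le4.
    by rewrite (steiner_block_eq _ _ _ _ _ _ hW DW CW le4).
  by case: #|_| => [|[|[|[|]]]].
have lin (f g : {set 'I_23} -> nat) a :
    \sum_(D in W) (f D + a * g D) = \sum_(D in W) f D + a * \sum_(D in W) g D.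
  by rewrite big_split big_distrr.
have sumC : \sum_(D in W) (D == C) = 1.
  by rewrite (bigD1 C) //= eqxx big1 // => D /andP[_ /negbTE->].
have : \sum_(D in W) ~~ odd #|D :&: C| == 0.
  have := eq_bigr (idx := 0) (op := addn) (r := index_enum _) _ even_bin.
  rewrite !lin big_split /= sumC.
  rewrite (witt23_sum_bin W C 0 253) // (witt23_sum_bin W C 1 539) //.
  rewrite (witt23_sum_bin W C 2 441) // (witt23_sum_bin W C 3 175) // => eqX.
  by rewrite -(eqn_add2r 539) -(eqn_add2r (4 * 175)) eqX.
by rewrite sum_nat_eq0 => /forallP/(_ B); rewrite BW; case: odd.
Qed.

(** There are 253 blocks, and only 77 of them contain a given point. *)
Lemma witt23_block_avoiding (W : {set {set 'I_23}}) (x : 'I_23) :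
  witt_design23 W -> exists2 B, B \in W & x \notin B.
Proof.
move=> hW; apply/exists_inP; apply: contraT; rewrite negb_exists_in.
move=> /forall_inP allx.
have := witt23_degree W [set x] 77 hW; rewrite cards1 => /(_ isT erefl).
have := witt23_degree W set0 253 hW; rewrite cards0 => /(_ isT erefl).
have -> : [set B in W | [set x] \subset B] = [set B in W | set0 \subset B].
  apply/setP => B; rewrite !inE sub1set sub0set; apply: andb_id2l => /allx.
  by rewrite negbK.
by move=> ->.
Qed.

(** * Sharply transitive sets *)

(** For each [x] in [B] and [y] in [C], exactly one [s] in [S] maps [x] to
    [y]; that pair contributes [x] to the intersection for this [s] alone. *)
Lemma sharply_transitive_sum (T : finType) (S : {set {perm T}})
    (B C : {set T}) :
  sharply_transitive S -> \sum_(s in S) #|B :&: s @^-1: C| = #|B| * #|C|.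
Proof.
move=> hS.
have nb x y : \sum_(s in S) (s x == y) = 1.
  have [s [[sS sxy] us]] := hS x y.
  rewrite (bigD1 s) //= sxy eqxx big1 // => s' /andP[s'S nes].
  by case: eqP => // s'xy; rewrite (us s') ?eqxx in nes.
transitivity (\sum_(s in S) \sum_(x in B) \sum_(y in C) (s x == y)).
  apply: eq_bigr => s _; rewrite -sum1_card.
  rewrite (eq_bigl (fun x => (x \in B) && (s x \in C))) ?big_mkcondr /=.
    apply: eq_bigr => x _; case: ifP => sxC.
      rewrite (bigD1 (s x)) //= eqxx big1 // => y /andP[_].
      by rewrite eq_sym => /negbTE ->.
    by rewrite big1 // => y yC; case: eqP => // sxy; rewrite sxy yC in sxC.
  by move=> x; rewrite !inE.
rewrite exchange_big -sum_nat_const; apply: eq_bigr => x _.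
by rewrite exchange_big -sum1_card; apply: eq_bigr => y _; apply: nb.
Qed.

Lemma card_sharply_transitive (T : finType) (S : {set {perm T}}) :
  0 < #|T| -> sharply_transitive S -> #|S| = #|T|.
Proof.
move=> /card_gt0P[x _] hS.
have := sharply_transitive_sum _ _ [set x] setT hS.
rewrite cards1 mul1n cardsT => <-; rewrite -sum1_card; apply: eq_bigr => s _.
by rewrite preimsetT setIT cards1.
Qed.

(** Extended to 23 points, [s] is an automorphism of the design, so the
    preimage of [C] is a block.  As [C] misses the last point, restricting to
    the other 22 points loses nothing of its intersection with that block. *)
Lemma M22_odd_meet (W : {set {set 'I_23}}) (C : {set 'I_23}) (s : 'S_22)
    (C0 := lift ord_max @^-1: C) :
  witt_design23 W -> C \in W -> ord_max \notin C -> s \in M22 W ->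
  odd #|C0 :&: s @^-1: C0|.
Proof.
move=> hW CW maxC; rewrite inE => /setIP[sN _].
set u := lift_perm _ _ s in sN.
have uCW : u @^-1: C \in W.
  rewrite -(astabs_act _ sN) /= setactE.
  suff -> : [set 'P%act x u | x in u @^-1: C] = C by [].
  apply/setP => y; apply/imsetP/idP => [[x] | yC].
    by rewrite inE => uxC ->.
  by exists (u^-1 y)%g; rewrite ?inE /= ?apermE permKV.
rewrite -(card_imset _ (lift_inj (h := ord_max))).
suff -> : [set lift ord_max x | x in C0 :&: s @^-1: C0] = C :&: u @^-1: C.
  exact: witt23_odd_meet hW CW uCW.
apply/setP => z; apply/imsetP/idP => [[x]|].
  by rewrite !inE => xC ->; rewrite lift_perm_lift.
rewrite 2!inE; case: (unliftP ord_max z) => [x -> | ->].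
  by exists x => //; rewrite !inE -(lift_perm_lift ord_max).
by rewrite (negbTE maxC).
Qed.

Theorem theorem4 (W : {set {set 'I_23}}) (hW : witt_design23 W) :
  ~ exists S : {set 'S_22}, S \subset M22 W /\ sharply_transitive S.
Proof.
move=> [S [/subsetP sSM hS]].
have [C CW maxC] := witt23_block_avoiding W ord_max hW.
set C0 := lift ord_max @^-1: C.
have cC0 : #|C0| = 7.
  case: hW => cW _; rewrite -[RHS](cW C CW).
  rewrite -(card_imset _ (lift_inj (h := ord_max))); apply: eq_card => z.
  apply/imsetP/idP => [[x]|zC]; first by rewrite inE => xC ->.
  case: (unliftP ord_max z) zC => [x -> xC | ->]; last by rewrite (negbTE maxC).
  by exists x; rewrite ?inE.
have := sharply_transitive_sum _ _ C0 C0 hS; rewrite cC0 => sum49.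
have : odd (\sum_(s in S) #|C0 :&: s @^-1: C0|) = odd #|S|.
  rewrite -sum1_card; apply: (big_ind2 (fun m n => odd m = odd n)) => //.
    by move=> m1 m2 n1 n2; rewrite !oddD => -> ->.
  by move=> s /sSM sM; rewrite (M22_odd_meet W).
by rewrite sum49 (card_sharply_transitive _ S _ hS) card_ord.
Qed.
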